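(* Let $R$ be an augmented Noetherian semiperfect algebra with Jacobson radical $J$ and let $$\xi:\quad 0\to K\to M\to N\to 0$$ be a short exact sequence of finitely generated $R$-modules. If the minimal Horseshoe Lemma holds for $\xi$, then: (1) $M$ is projective if and only if $K$ and $N$ are both projective; (2) $\mathrm{pd}(M)=\max\{\mathrm{pd}(K),\mathrm{pd}(N)\}$, where $\mathrm{pd}$ denotes projective dimension (possibly infinite).
   Context: Modules are left modules. $R$ is an associative unital algebra over a field. Semiperfect means every finitely generated $R$-module has a (finitely generated) projective cover. Augmented means that the canonical projection $R\to R/J$ is split by an algebra homomorphism $R/J\to R$. A projective resolution $\cdots\to P_1\xrightarrow{d_1}P_0\xrightarrow{d_0}M\to 0$ is minimal if $P_0\to M$ and each $P_n\to \ker d_{n-1}$ ($n\ge1$) are projective covers. The minimal Horseshoe Lemma holds for $\xi: 0\to K\to M\to N\to0$ if for any given minimal projective resolutions $\mathcal{P}_*\to K\to0$ and $\mathcal{Q}_*\to N\to0$ there are a minimal projective resolution $\mathcal{L}_*\to M\to 0$ and a short exact sequence of complexes $0\to\mathcal{P}_*\to\mathcal{L}_*\to\mathcal{Q}_*\to0$ such that the resulting diagram over $\xi$ (with the augmentations to $K$, $M$, $N$) is commutative with exact rows and columns. *)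

(* Defs.v *)
From HB Require Import structures.
From mathcomp Require Import all_boot all_order all_algebra.
From mathcomp Require Import boolp classical_sets constructive_ereal.

Set Implicit Arguments.
Unset Strict Implicit.
Unset Printing Implicit Defensive.

Import Order.TTheory GRing.Theory Num.Theory.
Local Open Scope ring_scope.

Section Modules.
Variable R : pzRingType.

Definition finitely_generated (V : lmodType R) : Prop :=
  exists (n : nat) (e : 'I_n -> V),
    forall v, exists c : 'I_n -> R, v = \sum_(i < n) c i *: e i.

(* Ascending chain condition on submodules. *)
Definition noetherian_module (V : lmodType R) : Prop :=
  forall S : nat -> {pred V},
    (forall n, GRing.submod_closed (S n)) ->
    (forall n, {subset S n <= S n.+1}) ->
    exists n, forall m, (n <= m)%N -> S m =i S n.

Definition maximal_submodule (V : lmodType R) (S : {pred V}) : Prop :=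
  [/\ GRing.submod_closed S,
      exists v, v \notin S
    & forall T : {pred V}, GRing.submod_closed T -> {subset S <= T} ->
        (exists v, v \notin T) -> {subset T <= S}].

Definition surjective_map (A B : Type) (f : A -> B) : Prop :=
  forall b, exists a, f a = b.

Definition ker_pred (V W : lmodType R) (f : {linear V -> W}) : {pred V} :=
  [pred v | f v == 0].

Definition exact_at (U V W : lmodType R)
    (f : {linear U -> V}) (g : {linear V -> W}) : Prop :=
  forall v, g v = 0 <-> exists u, f u = v.

Definition short_exact (U V W : lmodType R)
    (f : {linear U -> V}) (g : {linear V -> W}) : Prop :=
  [/\ injective f, exact_at f g & surjective_map g].

Definition projective (P : lmodType R) : Prop :=
  forall (A B : lmodType R) (g : {linear A -> B}) (f : {linear P -> B}),
    surjective_map g -> exists h : {linear P -> A}, forall x, g (h x) = f x.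

Definition superfluous (V : lmodType R) (S : {pred V}) : Prop :=
  forall T : {pred V}, GRing.submod_closed T ->
    (forall v, exists s t, [/\ s \in S, t \in T & v = s + t]) ->
    forall v, v \in T.

(* f, with codomain restricted to the submodule S of V, is a projective cover
   of S; restricting the codomain does not change the kernel. *)
Definition projective_cover_onto (P V : lmodType R) (f : {linear P -> V})
    (S : {pred V}) : Prop :=
  [/\ projective P,
      forall v, v \in S <-> exists x, f x = v
    & superfluous (ker_pred f)].

Definition projective_cover (P M : lmodType R) (f : {linear P -> M}) : Prop :=
  projective_cover_onto f predT.

Definition semiperfect : Prop :=
  forall M : lmodType R, finitely_generated M ->
    exists (P : lmodType R) (f : {linear P -> M}),
      finitely_generated P /\ projective_cover f.

(* res_diff n is the differential from degree n + 1 to degree n, and res_aug is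
   the augmentation, which plays the role of the differential in degree 0. *)
Record augmented_sequence (M : lmodType R) := AugmentedSequence {
  res_obj :> nat -> lmodType R;
  res_diff : forall n, {linear res_obj n.+1 -> res_obj n};
  res_aug : {linear res_obj 0%N -> M}
}.

Definition projective_resolution (M : lmodType R)
    (P : augmented_sequence M) : Prop :=
  [/\ forall n, projective (P n),
      surjective_map (res_aug P),
      exact_at (res_diff P 0%N) (res_aug P)
    & forall n, exact_at (res_diff P n.+1) (res_diff P n)].

Definition minimal_resolution (M : lmodType R)
    (P : augmented_sequence M) : Prop :=
  [/\ projective_resolution P,
      projective_cover (res_aug P),
      projective_cover_onto (res_diff P 0%N) (ker_pred (res_aug P))
    & forall n,
        projective_cover_onto (res_diff P n.+1) (ker_pred (res_diff P n))].

Definition minimal_horseshoe (K M N : lmodType R)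
    (f : {linear K -> M}) (g : {linear M -> N}) : Prop :=
  forall (P : augmented_sequence K) (Q : augmented_sequence N),
    minimal_resolution P -> minimal_resolution Q ->
    exists (L : augmented_sequence M)
        (i : forall n, {linear P n -> L n}) (p : forall n, {linear L n -> Q n}),
      [/\ minimal_resolution L,
          forall n, short_exact (i n) (p n),
          forall n x, i n (res_diff P n x) = res_diff L n (i n.+1 x),
          forall n y, p n (res_diff L n y) = res_diff Q n (p n.+1 y)
        & (forall x, f (res_aug P x) = res_aug L (i 0%N x)) /\
          (forall y, g (res_aug L y) = res_aug Q (p 0%N y))].

Definition pd_le (M : lmodType R) (n : nat) : Prop :=
  exists P : augmented_sequence M, projective_resolution P /\
    forall m, (n < m)%N -> forall x : P m, x = 0.

(* The least length of a projective resolution, +oo if none is finite; the zero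
   module has projective dimension 0. *)
Definition pd (M : lmodType R) : \bar int :=
  match pselect (exists n, `[< pd_le M n >]) with
  | left ex => (Posz (ex_minn ex))%:E
  | right _ => +oo%E
  end.

End Modules.

Definition left_noetherian (R : pzRingType) : Prop := noetherian_module R^o.

Section Augmented.
Variables (k : fieldType) (R : algType k).

(* The intersection of the maximal left ideals; the left ideals are the
   submodules of the regular left module R^o. *)
Definition jacobson : {pred R} :=
  fun x => `[< forall m : {pred R^o}, maximal_submodule m -> (x : R^o) \in m >].

Lemma jacobsonP x : reflect
  (forall m : {pred R^o}, maximal_submodule m -> (x : R^o) \in m)
  (x \in jacobson).
Proof. exact: asboolP. Qed.

Lemma submod_closedMl (m : {pred R^o}) (a x : R) :
  GRing.submod_closed m -> (x : R^o) \in m -> (a * x : R^o) \in m.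
Proof.
by case=> m0 mL xm; have := mL a x 0 xm m0; rewrite addr0.
Qed.

Lemma submod_closedD (m : {pred R^o}) (x y : R) :
  GRing.submod_closed m -> (x : R^o) \in m -> (y : R^o) \in m ->
  (x + y : R^o) \in m.
Proof.
by case=> m0 mL xm ym; have := mL 1 x y xm ym; rewrite scale1r.
Qed.

Lemma jacobson_zmod_closed : zmod_closed jacobson.
Proof.
split=> [|x y /jacobsonP xJ /jacobsonP yJ]; apply/jacobsonP => m mm.
  by case: mm => [[]].
have [mS _ _] := mm; rewrite addrC -mulN1r.
apply: submod_closedD => //; last exact: xJ.
by apply: submod_closedMl => //; apply: yJ.
Qed.

Lemma jacobsonMl a x : x \in jacobson -> a * x \in jacobson.
Proof.
move=> /jacobsonP xJ; apply/jacobsonP => m mm; have [mS _ _] := mm.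
by apply: submod_closedMl => //; apply: xJ.
Qed.

Lemma jacobsonMr a x : x \in jacobson -> x * a \in jacobson.
Proof.
move=> /jacobsonP xJ; apply/jacobsonP => m mm; have [mS _ mmax] := mm.
have [am|aNm] := boolP ((a : R^o) \in m); first exact: submod_closedMl.
pose ma : {pred R^o} := fun y => ((y : R) * a : R^o) \in m.
apply: (xJ ma); split.
- split=> [|c u v um vm]; rewrite /ma unfold_in; first by rewrite mul0r; case: mS.
  rewrite mulrDl -[c *: u]/(c * u) -mulrA.
  by apply: submod_closedD => //; apply: submod_closedMl.
- by exists 1; rewrite unfold_in /ma mul1r.
move=> T TS maT [w wT] y yT; apply: contraT => yNm.
pose my : {pred R^o} := fun z : R^o =>
  `[< exists b : R, (z - b * (y * a) : R^o) \in m >].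
have myS : GRing.submod_closed my.
  split=> [|c u v /asboolP[b bm] /asboolP[d dm]].
    by apply/asboolP; exists 0; rewrite mul0r subr0; case: mS.
  apply/asboolP; exists (c * b + d).
  have -> : c *: u + v - (c * b + d) * (y * a) =
     c * (u - b * (y * a)) + (v - d * (y * a)).
    by rewrite mulrDl mulrBr opprD addrACA -mulrA.
  by apply: submod_closedD => //; apply: submod_closedMl.
have mmy : {subset m <= my}.
  by move=> z zm; apply/asboolP; exists 0; rewrite mul0r subr0.
have [/asboolP[b bm]|aNmy] := boolP ((a : R^o) \in my).
  suff T1 : (1 : R^o) \in T.
    by move: wT; rewrite -[w]mulr1 (submod_closedMl w TS T1).
  rewrite -[1](subrK (b * y)); apply: submod_closedD => //.
    by apply: maT; rewrite unfold_in /ma mulrBl mul1r -mulrA.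
  exact: submod_closedMl.
have := mmax my myS mmy (ex_intro (fun v : R^o => v \notin my) a aNmy) (y * a).
have -> : (y * a : R^o) \in my.
  by apply/asboolP; exists 1; rewrite mul1r subrr; case: mS.
by move=> /(_ isT); move: yNm; rewrite unfold_in /ma => /negPf ->.
Qed.

Lemma maximal_left_ideal_exists : exists m : {pred R^o}, maximal_submodule m.
Proof.
pose ideal (A : set R^o) := GRing.submod_closed (fun x : R^o => `[< A x >]).
pose proper (A : set R^o) := A = set0 \/ ideal A /\ ~ A 1.
have [F FP Ftot|A [AP Amax]] := @Zorn_bigcup R^o proper.
  have [[X [FX [x Xx]]]|noX] := pselect (exists X, F X /\ (exists x, X x));
    last first.
    left; apply/seteqP; split=> // x [X FX Xx]; apply: noX.
    by exists X; split=> //; exists x.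
  right; have idl Y y : F Y -> Y y -> ideal Y /\ ~ Y 1.
    by move=> FY Yy; case: (FP _ FY) => // Y0; rewrite Y0 in Yy.
  split; last by move=> [Y FY Y1]; case: (idl Y 1 FY Y1).
  split=> [|c u v].
    by apply/asboolP; exists X => //; have [[/asboolP]] := idl _ _ FX Xx.
  move=> /asboolP[Y FY Yu] /asboolP[Z FZ Zv]; apply/asboolP.
  have [YZ|ZY] := Ftot _ _ FY FZ.
    have [[_ ZL] _] := idl _ _ FZ Zv; exists Z => //; apply/asboolP.
    by apply: ZL; apply/asboolP => //; apply: YZ.
  have [[_ YL] _] := idl _ _ FY Yu; exists Y => //; apply/asboolP.
  by apply: YL; apply/asboolP => //; apply: ZY.
have zP : proper [set (0 : R^o)]%classic.
  right; split; last by move=> /eqP; rewrite oner_eq0.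
  split=> [|c u v /asboolP -> /asboolP ->]; apply/asboolP => //.
  by rewrite scaler0 addr0.
have AI : ideal A /\ ~ A 1.
  case: AP => // A0; exfalso; apply: (Amax [set (0 : R^o)]%classic) => //.
  by rewrite A0; split=> // /(_ 0); apply.
have [AS A1] := AI.
exists (fun x => `[< A x >]); split=> //; first by exists 1; apply/asboolP.
move=> T TS AT [w wT] x xT; apply: contraT => /asboolP xA; exfalso.
apply: (Amax (fun x => x \in T)).
  split=> [y Ay|sub]; first by apply: AT; apply/asboolP.
  exact/xA/sub.
right; split.
  case: TS => T0 TL.
  by split=> [|c u v /asboolP uT /asboolP vT]; apply/asboolP => //; apply: TL.
by move=> T1; move: wT; rewrite -[w]mulr1 (submod_closedMl w TS T1).
Qed.

Lemma jacobson1 : 1 \notin jacobson.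
Proof.
apply/negP => /jacobsonP J1; have [m mm] := maximal_left_ideal_exists.
have [mS [w wm] _] := mm.
by move: wm; rewrite -[w]mulr1 (submod_closedMl w mS (J1 _ mm)).
Qed.

HB.instance Definition _ :=
  GRing.isZmodClosed.Build R jacobson jacobson_zmod_closed.

(* The library's additive quotient R/J, made into a k-algebra below. *)
Definition quot_jacobson : Type := Quotient.quot jacobson.
HB.instance Definition _ := GRing.Zmodule.on quot_jacobson.

Definition jac_pi (x : R) : quot_jacobson :=
  (\pi_(Quotient.quot jacobson) x)%qT.
Definition jac_repr (x : quot_jacobson) : R :=
  repr (x : Quotient.quot jacobson).

Lemma jac_reprK x : jac_pi (jac_repr x) = x.
Proof. exact: reprK. Qed.

Lemma jac_pi_eq x y : (jac_pi x = jac_pi y) <-> (x - y \in jacobson).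
Proof.
rewrite [_ \in _](Quotient.idealrBE jacobson x y).
by split=> [/eqP|/eqP].
Qed.

Lemma jac_pi0 : jac_pi 0 = 0.
Proof. by rewrite /jac_pi piE. Qed.

Lemma jac_piD x y : jac_pi (x + y) = jac_pi x + jac_pi y.
Proof. exact: Quotient.pi_add. Qed.

Definition jac_one : quot_jacobson := jac_pi 1.
Definition jac_mul (x y : quot_jacobson) := jac_pi (jac_repr x * jac_repr y).
Definition jac_scale (c : k) (x : quot_jacobson) := jac_pi (c *: jac_repr x).

Lemma jac_piM x y : jac_pi (x * y) = jac_mul (jac_pi x) (jac_pi y).
Proof.
apply/jac_pi_eq; set x' := jac_repr _; set y' := jac_repr _.
have -> : x * y - x' * y' = (x - x') * y + x' * (y - y').
  by rewrite mulrBl mulrBr addrA subrK.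
by apply: rpredD; [apply: jacobsonMr|apply: jacobsonMl];
  apply/jac_pi_eq; rewrite jac_reprK.
Qed.

Lemma jac_piZ c x : jac_pi (c *: x) = jac_scale c (jac_pi x).
Proof.
apply/jac_pi_eq; rewrite -scalerBr -[_ - _]mul1r scalerAl.
by apply: jacobsonMl; apply/jac_pi_eq; rewrite jac_reprK.
Qed.

Lemma jac_mulA : associative jac_mul.
Proof.
move=> x y z; rewrite -[x]jac_reprK -[y]jac_reprK -[z]jac_reprK.
by rewrite -!jac_piM mulrA.
Qed.

Lemma jac_mul1r : left_id jac_one jac_mul.
Proof. by move=> x; rewrite -[x]jac_reprK -jac_piM mul1r. Qed.

Lemma jac_mulr1 : right_id jac_one jac_mul.
Proof. by move=> x; rewrite -[x]jac_reprK -jac_piM mulr1. Qed.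

Lemma jac_mulDl : left_distributive jac_mul +%R.
Proof.
move=> x y z; rewrite -[x]jac_reprK -[y]jac_reprK -[z]jac_reprK.
by rewrite -jac_piD -!jac_piM -jac_piD mulrDl.
Qed.

Lemma jac_mulDr : right_distributive jac_mul +%R.
Proof.
move=> x y z; rewrite -[x]jac_reprK -[y]jac_reprK -[z]jac_reprK.
by rewrite -jac_piD -!jac_piM -jac_piD mulrDr.
Qed.

Lemma jac_one_neq0 : jac_one != 0.
Proof.
rewrite -jac_pi0; apply/eqP => /jac_pi_eq; rewrite subr0.
exact/negP/jacobson1.
Qed.

HB.instance Definition _ := GRing.Zmodule_isNzRing.Build quot_jacobson
  jac_mulA jac_mul1r jac_mulr1 jac_mulDl jac_mulDr jac_one_neq0.

Lemma jac_scaleA a b x : jac_scale a (jac_scale b x) = jac_scale (a * b) x.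
Proof. by rewrite -[x]jac_reprK -!jac_piZ scalerA. Qed.

Lemma jac_scale1 : left_id 1 jac_scale.
Proof. by move=> x; rewrite -[x]jac_reprK -jac_piZ scale1r. Qed.

Lemma jac_scaleDr : right_distributive jac_scale +%R.
Proof.
move=> a x y; rewrite -[x]jac_reprK -[y]jac_reprK.
by rewrite -jac_piD -!jac_piZ -jac_piD scalerDr.
Qed.

Lemma jac_scaleDl x : {morph jac_scale^~ x : a b / a + b}.
Proof.
by move=> a b; rewrite -[x]jac_reprK -!jac_piZ -jac_piD scalerDl.
Qed.

HB.instance Definition _ := GRing.Zmodule_isLmodule.Build k quot_jacobson
  jac_scaleA jac_scale1 jac_scaleDr jac_scaleDl.

Lemma jac_scaleAl (a : k) (x y : quot_jacobson) : a *: (x * y) = (a *: x) * y.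
Proof.
rewrite -[x]jac_reprK -[y]jac_reprK.
rewrite -[_ * _]jac_piM -[a *: jac_pi (_ * _)]jac_piZ -[a *: jac_pi _]jac_piZ.
by rewrite -[RHS]jac_piM scalerAl.
Qed.

HB.instance Definition _ :=
  GRing.Lmodule_isLalgebra.Build k quot_jacobson jac_scaleAl.

Lemma jac_scaleAr (a : k) (x y : quot_jacobson) : a *: (x * y) = x * (a *: y).
Proof.
rewrite -[x]jac_reprK -[y]jac_reprK.
rewrite -[_ * _]jac_piM -[a *: jac_pi (_ * _)]jac_piZ -[a *: jac_pi _]jac_piZ.
by rewrite -[RHS]jac_piM scalerAr.
Qed.

HB.instance Definition _ :=
  GRing.Lalgebra_isAlgebra.Build k quot_jacobson jac_scaleAr.

Definition augmented : Prop :=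
  exists s : {lrmorphism quot_jacobson -> R}, cancel s jac_pi.

End Augmented.

(* Main.v *)
(* A minimal projective resolution P of a module is as short as any other
   projective resolution Q: lifting the identity gives chain maps P -> Q -> P,
   and the composite endomorphism of P is injective in each degree because the
   kernels of the differentials are superfluous, so Q m = 0 forces P m = 0.
   Hence pd <= n can be read off minimal resolutions, which exist for finitely
   generated modules since R is Noetherian and semiperfect. The horseshoe lemma
   gives exact sequences 0 -> P m -> L m -> Q m -> 0 between the terms of
   minimal resolutions of K, M and N, so L m = 0 iff P m = 0 and Q m = 0.
   Projective modules are those with pd <= 0. *)

Require Import Defs.
From HB Require Import structures.
From mathcomp Require Import all_boot all_order all_algebra.
From mathcomp Require Import boolp constructive_ereal.

Set Implicit Arguments.
Unset Strict Implicit.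
Unset Printing Implicit Defensive.

Import Order.TTheory GRing.Theory Num.Theory.
Local Open Scope ring_scope.

(** * Kernels as modules in their own right *)

Section KernelModule.
Variables (R : pzRingType) (V W : lmodType R) (f : {linear V -> W}).

Lemma ker_pred_submod_closed : GRing.submod_closed (ker_pred f).
Proof.
split=> [|a u v]; rewrite !inE ?linear0 // => /eqP fu /eqP fv.
by rewrite linearP fu fv scaler0 addr0.
Qed.

HB.instance Definition _ :=
  GRing.isSubmodClosed.Build R V (ker_pred f) ker_pred_submod_closed.

(** Projectivity and semiperfectness quantify over modules, so the predicate [ker_pred f] must
    become a module before they apply to it. *)
Record kernel : Type :=
  Kernel { kernel_val : V; kernel_valP : kernel_val \in ker_pred f }.

HB.instance Definition _ := [isSub for kernel_val].
HB.instance Definition _ := [Choice of kernel by <:].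
HB.instance Definition _ := [SubChoice_isSubLmodule of kernel by <:].

Definition kernel_incl : {linear kernel -> V} := val.

Lemma kernel_incl_inj : injective kernel_incl.
Proof. exact: val_inj. Qed.

Lemma kernel_inclP x : f (kernel_incl x) = 0.
Proof. by apply/eqP; exact: (kernel_valP x). Qed.

Lemma kernel_lift v : f v = 0 -> exists x, kernel_incl x = v.
Proof.
by move=> fv; have fv' : v \in ker_pred f by [apply/eqP]; exists (Kernel fv').
Qed.

End KernelModule.

(** * Finite generation of submodules over a Noetherian ring *)

Section Span.
Variable R : pzRingType.

(** Generators are peeled off one at a time, so that inductions on the list need no indexed sums. *)
Fixpoint span (V : lmodType R) (s : seq V) (v : V) : Prop :=
  if s is e :: s' then exists c, span s' (v - c *: e) else v = 0.

Section Theory.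
Variable V : lmodType R.
Implicit Types (s t : seq V) (u v : V).

Lemma span0 s : span s 0.
Proof. by elim: s => //= e s IHs; exists 0; rewrite scale0r subr0. Qed.

Lemma spanP a s u v : span s u -> span s v -> span s (a *: u + v).
Proof.
elim: s u v => [|e s IHs] u v /=; first by move=> -> ->; rewrite scaler0 addr0.
move=> [c uc] [d vd]; exists (a * c + d).
by rewrite scalerDl opprD addrACA -scalerA -scalerBr; apply: IHs.
Qed.

Lemma spanD s u v : span s u -> span s v -> span s (u + v).
Proof. by move=> su sv; rewrite -[u]scale1r; apply: spanP. Qed.

Lemma spanB s u v : span s u -> span s v -> span s (u - v).
Proof. by move=> su sv; rewrite addrC -scaleN1r; apply: spanP. Qed.

Lemma span_catl s t v : span t v -> span (s ++ t) v.
Proof.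
by move=> tv; elim: s => //= e s IHs; exists 0; rewrite scale0r subr0.
Qed.

Lemma span_catr s t v : span s v -> span (s ++ t) v.
Proof.
elim: s v => [|e s IHs] v /=; first by move=> ->; apply: span0.
by move=> [c /IHs]; exists c.
Qed.

Lemma span_head e s : span (e :: s) e.
Proof. by exists 1; rewrite scale1r subrr; apply: span0. Qed.

Lemma span_submod_closed s : GRing.submod_closed (fun v => `[< span s v >]).
Proof.
split=> [|a u v /asboolP su /asboolP sv]; apply/asboolP; first exact: span0.
exact: spanP.
Qed.

Lemma span_sub s (S : {pred V}) v : GRing.submod_closed S ->
  {subset s <= S} -> span s v -> v \in S.
Proof.
case=> S0 SL; elim: s v => [|e s IHs] v sS /=; first by move=> ->.
move=> [c vc]; rewrite -[v](subrK (c *: e)) addrC.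
apply: SL; first by apply: sS; rewrite mem_head.
by apply: IHs vc => x xs; apply: sS; rewrite inE xs orbT.
Qed.

Lemma span_sum I (r : seq I) (c : I -> R) (e : I -> V) :
  span [seq e i | i <- r] (\sum_(i <- r) c i *: e i).
Proof.
elim: r => [|i r IHr] /=; first by rewrite big_nil.
by exists (c i); rewrite big_cons addrC addrA addNr add0r.
Qed.

Lemma span_coef s v : span s v ->
  exists c : nat -> R, v = \sum_(i < size s) c i *: s`_i.
Proof.
elim: s v => [|e s IHs] v /=; first by move=> ->; exists (fun=> 0); rewrite big_ord0.
move=> [a /IHs[c vc]]; exists (fun i => if i is j.+1 then c j else a).
by rewrite big_ord_recl /= -[RHS]addrC -[LHS](subrK (a *: e)) vc.
Qed.

Lemma finitely_generatedP :
  finitely_generated V <-> exists s, forall v, span s v.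
Proof.
split=> [[n [e eV]]|[s sV]].
  exists [seq e i | i <- index_enum 'I_n] => v.
  by have [c ->] := eV v; apply: span_sum.
exists (size s), (fun i => s`_i) => v; have [c ->] := span_coef (sV v).
by exists (fun i => c i).
Qed.

End Theory.

Lemma span_map_inj (V W : lmodType R) (f : {linear V -> W}) (s : seq V) v :
  injective f -> span (map f s) (f v) -> span s v.
Proof.
move=> f_inj; elim: s v => [|e s IHs] v /=.
  by rewrite -[0](linear0 f) => /f_inj.
by move=> [c]; rewrite -linearZ -linearB => /IHs; exists c.
Qed.

(** Otherwise every finite list in [I] misses some element of [I]. Adding missed elements one by one
    gives an ascending chain of spans that never stabilises. *)
Lemma left_ideal_span (I : {pred R^o}) :
  left_noetherian R -> GRing.submod_closed I ->
  exists s : seq R^o, {subset s <= I} /\ forall x, x \in I -> span s x.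
Proof.
move=> noethR I_closed; apply: contrapT => noS.
have [pick pickP] : {pick : seq R^o -> R^o & forall s, {subset s <= I} ->
    pick s \in I /\ ~ span s (pick s)}.
  apply: (@choice _ _ (fun s x => {subset s <= I} -> x \in I /\ ~ span s x)) => s.
  (* The value 0 is a dummy for lists not contained in [I]. *)
  have [sI|?] := pselect {subset s <= I}; last by exists 0.
  apply: contrapT => noX; apply: noS; exists s; split=> // x xI.
  by apply: contrapT => Nsx; apply: noX; exists x.
pose chain n := iter n (fun s => pick s :: s) [::].
have chainI n : {subset chain n <= I}.
  elim: n => //= n IHn x; rewrite inE => /orP[/eqP ->|/IHn //].
  by have [] := pickP _ IHn.
have [|n x /asboolP xn|n /(_ n.+1 (leqnSn n))/(_ (pick (chain n)))] :=
    noethR (fun n x => `[< span (chain n) x >]).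
- by move=> n; apply: span_submod_closed.
- by apply/asboolP; apply: (@span_catl _ [:: _]).
have [_ Npick] := pickP _ (chainI n).
rewrite -!topredE /=; have /asboolP -> := @span_head _ (pick (chain n)) (chain n).
by move=> /esym/asboolP.
Qed.

(* Induction on the generators: the coefficients at e of the elements of S form
   a finitely generated left ideal, and lifting generators of that ideal to S
   reduces to the submodule of the elements of S spanned by s. *)
Lemma submodule_span (V : lmodType R) (s : seq V) (S : {pred V}) :
  left_noetherian R -> GRing.submod_closed S -> (forall v, v \in S -> span s v) ->
  exists t, {subset t <= S} /\ forall v, v \in S -> span t v.
Proof.
move=> noethR; elim: s S => [|e s IHs] S S_closed sS; first by exists [::].
have [S0 SL] := S_closed.
pose I : {pred R^o} :=
  fun r => `[< exists2 v, v \in S & span s (v - (r : R) *: e) >].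
have I_closed : GRing.submod_closed I.
  split=> [|a x y /asboolP[u uS ux] /asboolP[v vS vy]]; apply/asboolP.
    by exists 0 => //; rewrite scale0r subr0; apply: span0.
  exists (a *: u + v); first exact: SL.
  rewrite scalerDl -[a *: x]/(a * x) -scalerA opprD addrACA -scalerBr.
  exact: spanP.
have [r [rI rP]] := left_ideal_span noethR I_closed.
have [t1 [t1S t1P]] : exists t1, {subset t1 <= S} /\
    forall x, span r x -> exists2 w, span t1 w & span s (w - (x : R) *: e).
  elim: r rI {rP} => [|y r IHr] rI.
    exists [::]; split=> // x ->; exists 0 => //.
    by rewrite scale0r subr0; apply: span0.
  have [x xr|t1 [t1S t1P]] := IHr; first by apply: rI; rewrite inE xr orbT.
  have /asboolP[u uS uy] : y \in I by apply: rI; rewrite mem_head.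
  exists (u :: t1); split=> [x|x [c /t1P[w wt1 ws]]].
    by rewrite inE => /orP[/eqP ->|/t1S].
  exists (c *: u + w); first by exists c; rewrite addrAC subrr add0r.
  have -> : c *: u + w - (x : R) *: e =
      c *: (u - (y : R) *: e) + (w - ((x - c *: y : R^o) : R) *: e).
    rewrite scalerBl -[c *: y]/(c * y) -scalerA scalerBr addrACA -opprD.
    by rewrite [_ + (_ - _)]addrC subrK.
  exact: spanP.
have [|v|t2 [t2S t2P]] := IHs (fun v => (v \in S) && `[< span s v >]).
- split=> [|a u v /andP[uS /asboolP us] /andP[vS /asboolP vs]]; apply/andP.
    by split=> //; apply/asboolP; apply: span0.
  by split; [apply: SL|apply/asboolP; apply: spanP].
- by move=> /andP[_ /asboolP].
exists (t1 ++ t2); split=> [v|v vS].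
  by rewrite mem_cat => /orP[/t1S //|/t2S /andP[]].
have [c vc] := sS v vS.
have [|w wt1 ws] := t1P c; first by apply/rP/asboolP; exists v.
(* Modulo the span of [s], both [v] and [w] equal [c *: e]. Hence [v - w] lies in [S] and in the
   span of [s], where [t2] generates. *)
rewrite -[v](subrK w) addrC; apply: spanD; first exact: span_catr.
have wS : w \in S by apply: span_sub wt1.
apply/span_catl/t2P/andP; split.
  by rewrite addrC -scaleN1r; apply: SL.
apply/asboolP; have -> : v - w = (v - c *: e) - (w - c *: e).
  by rewrite opprB addrA subrK.
exact: spanB.
Qed.

Lemma kernel_finitely_generated (V W : lmodType R) (f : {linear V -> W}) :
  left_noetherian R -> finitely_generated V -> finitely_generated (kernel f).
Proof.
move=> noethR /finitely_generatedP[s sV]; apply/finitely_generatedP.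
have [t [tK tP]] := submodule_span noethR (ker_pred_submod_closed f)
  (fun v _ => sV v).
(* The generators found in [V] lie in the kernel, so they lift along the inclusion. *)
have [t' tE] : exists t', t = map (kernel_incl f) t'.
  elim: t tK {tP} => [|v t IHt] tK; first by exists [::].
  have [x vx|t' ->] := IHt; first by apply: tK; rewrite inE vx orbT.
  have /eqP/kernel_lift[x <-] := tK v (mem_head _ _).
  by exists (x :: t').
exists t' => x; apply: (span_map_inj (@kernel_incl_inj _ _ _ f)).
by rewrite -tE; apply/tP/kernel_valP.
Qed.

End Span.

(** * Existence of minimal resolutions *)

Section Resolutions.
Variable R : pzRingType.

(** Here [g] need only cover the image of [f]. The pullback of [f] and [g], built as the kernel of
    [f x - g a] on [P * A], then projects onto [P]; a section of this projection, followed by the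
    projection to [A], is the lift. *)
Lemma projective_lift (P A B : lmodType R) (g : {linear A -> B})
    (f : {linear P -> B}) :
  projective P -> (forall x, exists a, g a = f x) ->
  exists h : {linear P -> A}, forall x, g (h x) = f x.
Proof.
move=> projP fg.
pose d (z : P * A) := f z.1 - g z.2.
have d_lin : linear d.
  by move=> a u v; rewrite /d /= (linearP f) (linearP g) scalerBr opprD addrACA.
pose dL : {linear (P * A)%type -> B} :=
  HB.pack d (GRing.isLinear.Build _ _ _ _ d d_lin).
have [|h hE] := projP (kernel dL) P (fst \o kernel_incl dL) idfun.
  move=> x; have [a ax] := fg x.
  by have [|z zE] := @kernel_lift _ _ _ dL (x, a);
    [rewrite /= /d ax subrr | exists z; apply: (congr1 fst zE)].
exists (snd \o (kernel_incl dL \o h)) => x.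
by have /subr0_eq <- := kernel_inclP (h x); apply: (congr1 f (hE x)).
Qed.

Lemma kernel_cover (V W : lmodType R) (f : {linear V -> W}) :
  left_noetherian R -> semiperfect R -> finitely_generated V ->
  exists (P : lmodType R) (d : {linear P -> V}),
    finitely_generated P /\ projective_cover_onto d (ker_pred f).
Proof.
move=> noethR semiR V_fg.
have [P [d [P_fg [projP dK d_sup]]]] :=
  semiR _ (kernel_finitely_generated f noethR V_fg).
exists P, (kernel_incl f \o d); split=> //; split=> [//|v|T T_closed PT].
  split=> [/eqP /kernel_lift[y <-]|[x <-]]; last by apply/eqP/kernel_inclP.
  by have [/(_ isT)[x <-] _] := dK y; exists x.
(* The inclusion is injective, so composing with it leaves the kernel of [d] unchanged. *)
exact: d_sup.
Qed.

(* A stage carries the target of its map so that, when stages are iterated, the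
   target of each stage is convertible to the source of the previous one. *)
Record syzygy_stage := SyzygyStage {
  stage_src : lmodType R;
  stage_tgt : lmodType R;
  stage_map : {linear stage_src -> stage_tgt};
  stage_fg : finitely_generated stage_src
}.

Lemma minimal_resolution_exists (M : lmodType R) :
  left_noetherian R -> semiperfect R -> finitely_generated M ->
  exists P : augmented_sequence M, minimal_resolution P.
Proof.
move=> noethR semiR M_fg.
have [P0 [e0 [P0_fg e0_cover]]] := semiR M M_fg.
(* Choice turns the existence of covers into a function that can be iterated. *)
pose coverP s := cid (kernel_cover (stage_map s) noethR semiR (@stage_fg s)).
pose diffP s := cid (svalP (coverP s)).
pose next s := SyzygyStage (sval (diffP s)) (proj1 (svalP (diffP s))).
have nextP s : projective_cover_onto (stage_map (next s)) (ker_pred (stage_map s)).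
  exact: (proj2 (svalP (diffP s))).
pose stage n := iter n next (SyzygyStage e0 P0_fg).
(* Stage 0 is the augmentation, so the differential of index [n] is the map of stage [n.+1]. *)
pose P := AugmentedSequence (fun n => stage_map (stage n.+1)) e0.
have dP n : projective_cover_onto (res_diff P n.+1) (ker_pred (res_diff P n)).
  exact: nextP.
have d0 : projective_cover_onto (res_diff P 0%N) (ker_pred (res_aug P)).
  exact: nextP.
exists P; split=> //; split=> [n|b|v|n v].
- case: n => [|n]; first by case: e0_cover.
  by case: n => [|n]; [case: d0 | case: (dP n)].
- by case: e0_cover => _ /(_ b)[/(_ isT)].
- by case: d0 => _ /(_ v) <- _; rewrite inE; split=> [->|/eqP].
- by case: (dP n) => _ /(_ v) <- _; rewrite inE; split=> [->|/eqP].
Qed.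

(** * Comparison of resolutions *)

Lemma chain_lift (M : lmodType R) (P Q : augmented_sequence M) :
  projective_resolution P -> projective_resolution Q ->
  exists phi : forall n, {linear P n -> Q n},
    (forall x, res_aug Q (phi 0%N x) = res_aug P x) /\
    forall n x, res_diff Q n (phi n.+1 x) = phi n (res_diff P n x).
Proof.
move=> [projP _ P0 PS] [_ augQ Q0 QS].
have [phi0 phi0E] := projP 0%N _ _ (res_aug Q) (res_aug P) augQ.
have [x|phi1 phi1E] :=
    projective_lift (g := res_diff Q 0%N) (f := phi0 \o res_diff P 0%N) (projP 1%N).
  by apply/Q0; rewrite /= phi0E; apply/P0; exists x.
(* A stage holds two consecutive lifts and their commuting square: the square shows that the next
   map to be lifted lands in cycles. Successive stages share a lift, so the squares fit together. *)
pose stage n := {p : {linear P n -> Q n} * {linear P n.+1 -> Q n.+1} |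
  forall x, res_diff Q n (p.2 x) = p.1 (res_diff P n x)}.
have next n (s : stage n) : {h : {linear P n.+2 -> Q n.+2} |
    forall x, res_diff Q n.+1 (h x) = (sval s).2 (res_diff P n.+1 x)}.
  apply: cid; case: s => [[p q] /= pq].
  apply: (projective_lift (f := q \o res_diff P n.+1) (projP n.+2)) => x.
  apply/QS; rewrite /= pq (_ : res_diff P n _ = 0) ?linear0 //.
  by apply/PS; exists x.
pose stageS n (s : stage n) : stage n.+1 :=
  exist _ ((sval s).2, sval (next n s)) (svalP (next n s)).
pose s := nat_rect stage (exist _ (phi0, phi1) phi1E) stageS.
exists (fun n => (sval (s n)).1); split=> // n x.
exact: (svalP (s n) x).
Qed.

(** A Nakayama-type argument, used twice. First [P] is the sum of the kernel of [d] and the image of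
    [h], so [h] is onto and has a section [s] by projectivity. As the kernel of [h] lies in that of
    [d], the same argument makes [s] onto, and then [h] is injective. *)
Lemma superfluous_endo_bij (P V : lmodType R) (d : {linear P -> V})
    (h : {linear P -> P}) :
  projective P -> superfluous (ker_pred d) ->
  (forall x, exists y, d (h y) = d x) -> (forall x, h x = 0 -> d x = 0) ->
  injective h /\ surjective_map h.
Proof.
move=> projP d_sup dh hd.
have img_closed (u : {linear P -> P}) :
    GRing.submod_closed (fun x => `[< exists y, u y = x >]).
  split=> [|a x y /asboolP[x' <-] /asboolP[y' <-]]; apply/asboolP.
    by exists 0; rewrite linear0.
  by exists (a *: x' + y'); rewrite linearP.
have h_surj : surjective_map h.
  move=> x; apply/asboolP; move: x; apply: d_sup => // x.
  have [y yx] := dh x; exists (x - h y), (h y); split.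
  - by rewrite inE linearB yx subrr.
  - by apply/asboolP; exists y.
  - by rewrite subrK.
split=> //; have [s hs] := projP P P h idfun h_surj.
have s_surj : surjective_map s.
  move=> x; apply/asboolP; move: x; apply: d_sup => // x.
  exists (x - s (h x)), (s (h x)); split.
  - by rewrite inE; apply/eqP/hd; rewrite linearB hs subrr.
  - by apply/asboolP; exists (h x).
  - by rewrite subrK.
by move=> x y; have [x' <-] := s_surj x; have [y' <-] := s_surj y; rewrite !hs => /= ->.
Qed.

Lemma minimal_resolution_endo_inj (M : lmodType R) (P : augmented_sequence M)
    (h : forall n, {linear P n -> P n}) :
  minimal_resolution P ->
  (forall x, res_aug P (h 0%N x) = res_aug P x) ->
  (forall n x, res_diff P n (h n.+1 x) = h n (res_diff P n x)) ->
  forall n, injective (h n).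
Proof.
move=> [[projP _ P0 PS] [_ _ aug_sup] [_ _ d0_sup] dS_sup] h0 hS n.
have d_sup m : superfluous (ker_pred (res_diff P m)).
  by case: m => // m; have [] := dS_sup m.
(* The third clause is what carries surjectivity of h on cycles to the next
   degree. *)
suff [] : [/\ injective (h n), surjective_map (h n) & forall z,
    (exists x, res_diff P n x = h n z) -> exists x, res_diff P n x = z] by [].
elim: n => [|n [h_inj h_surj h_im]].
  have [|x hx0|h_inj h_surj] := superfluous_endo_bij (h := h 0%N) (projP 0%N) aug_sup.
  - by move=> x; exists x.
  - by rewrite -h0 hx0 linear0.
  by split=> // z [x xz]; apply/P0; rewrite -h0; apply/P0; exists x.
have [x|x hx0|h_inj' h_surj'] :=
    superfluous_endo_bij (h := h n.+1) (projP n.+1) (d_sup n).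
- have [z zx] := h_surj (res_diff P n x).
  have [|y yz] := h_im z; first by exists x.
  by exists y; rewrite hS yz.
- by apply: h_inj; rewrite -hS hx0 !linear0.
split=> // z [x xz]; apply/PS; apply: h_inj; rewrite -hS linear0.
by apply/PS; exists x.
Qed.

(** * Projective dimension read off minimal resolutions *)

Lemma minimal_pd_le (M : lmodType R) (P : augmented_sequence M) n :
  minimal_resolution P ->
  pd_le M n <-> forall m, (n < m)%N -> forall x : P m, x = 0.
Proof.
move=> minP; have [resP _ _ _] := minP; split=> [[Q [resQ Q0]]|P0]; last by exists P.
have [phi [phi0 phiS]] := chain_lift resP resQ.
have [psi [psi0 psiS]] := chain_lift resQ resP.
have h_inj := minimal_resolution_endo_inj (h := fun m => psi m \o phi m) minP.
move=> m nm x; apply: (h_inj _ _ m) => [y|l y|] /=.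
- by rewrite psi0 phi0.
- by rewrite psiS phiS.
by rewrite (Q0 m nm (phi m x)) !linear0.
Qed.

Lemma projective_pd_le0 (M : lmodType R) : projective M <-> pd_le M 0.
Proof.
split=> [projM|[P [[projP augP P0 _] Pm0]] A B g f g_surj]; last first.
  have aug_inj : injective (res_aug P).
    move=> x y xy; apply/subr0_eq; have /P0[z <-] : res_aug P (x - y) = 0.
      by rewrite linearB xy subrr.
    by rewrite (Pm0 1%N isT z) linear0.
  have [h hE] := projP 0%N A B g (f \o res_aug P) g_surj.
  (* A resolution concentrated in degree 0 has a bijective augmentation; its set-theoretic inverse
     is linear by injectivity. *)
  have [s sK] := choice augP.
  have s_lin : linear s by move=> a x y; apply: aug_inj; rewrite linearP !sK.
  pose sL : {linear M -> P 0%N} := HB.pack s (GRing.isLinear.Build _ _ _ _ s s_lin).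
  by exists (h \o sL) => x; rewrite /= hE /= sK.
(* Row vectors of length 0 serve as the zero module in all positive degrees. *)
pose Z : lmodType R := 'rV[R]_0.
have Z0 (x : Z) : x = 0 by apply: thinmx0.
pose obj n : lmodType R := if n is 0%N then M else Z.
pose P := @AugmentedSequence R M obj (fun n => \0) idfun.
exists P; split; last by case.
split=> [[|n]//||x|n x].
- by move=> A B g f _; exists \0 => x; rewrite (Z0 x) !linear0.
- by move=> x; exists x.
- by split=> [/= ->|[y <-]]; first by exists 0.
- by split=> _ //; exists 0; rewrite (Z0 x).
Qed.

Lemma pd_leW (M : lmodType R) m n : (m <= n)%N -> pd_le M m -> pd_le M n.
Proof.
move=> mn [P [resP P0]]; exists P; split=> // l nl; apply: P0.
exact: leq_ltn_trans nl.
Qed.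

Lemma pd_finite (M : lmodType R) n :
  pd_le M n -> (forall m, pd_le M m -> (n <= m)%N) -> pd M = (Posz n)%:E%E.
Proof.
move=> Mn n_min; rewrite /pd; case: pselect => [ex|[]]; last first.
  by exists n; apply/asboolP.
case: ex_minnP => m /asboolP Mm m_min; congr (Posz _)%:E%E.
by apply/eqP; rewrite eqn_leq n_min // andbT; apply/m_min/asboolP.
Qed.

Lemma pd_infinite (M : lmodType R) : (forall n, ~ pd_le M n) -> pd M = +oo%E.
Proof.
move=> noM; rewrite /pd; case: pselect => // ex; exfalso;
by case: ex => n /asboolP /noM.
Qed.

Lemma pd_cases (M : lmodType R) :
  (exists2 n, pd_le M n & forall m, pd_le M m -> (n <= m)%N) \/
  forall n, ~ pd_le M n.
Proof.
have [ex|noM] := pselect (exists n, `[< pd_le M n >]); [left|right].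
  case: (ex_minnP ex) => n /asboolP Mn n_min; exists n => // m Mm.
  exact/n_min/asboolP.
by move=> n Mn; apply: noM; exists n; apply/asboolP.
Qed.

(** The bounds [n] with [pd_le] form an upward closed set, and [pd] is its least element, or
    infinity if it is empty. Intersecting two such sets takes the maximum of their least
    elements. *)
Lemma pd_max (K M N : lmodType R) :
  (forall n, pd_le M n <-> pd_le K n /\ pd_le N n) ->
  pd M = Order.max (pd K) (pd N).
Proof.
move=> MKN.
have [[a Ka a_min]|noK] := pd_cases K; last first.
  rewrite (pd_infinite noK) maxye; apply: pd_infinite => n /MKN[Kn _].
  exact: noK Kn.
have [[b Nb b_min]|noN] := pd_cases N; last first.
  rewrite (pd_infinite noN) maxey; apply: pd_infinite => n /MKN[_ Nn].
  exact: noN Nn.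
rewrite (pd_finite Ka a_min) (pd_finite Nb b_min).
have -> : Order.max (Posz a)%:E%E (Posz b)%:E%E = (Posz (maxn a b))%:E%E.
  rewrite -EFin_max; congr (_%:E)%E.
  by case: leqP => ?; [apply/max_idPr | apply/max_idPl/ltW].
apply: pd_finite => [|m /MKN[Km Nm]]; last by rewrite geq_max a_min ?b_min.
by apply/MKN; split; [apply: pd_leW Ka|apply: pd_leW Nb];
  rewrite ?leq_maxl ?leq_maxr.
Qed.

Lemma minimal_horseshoe_pd_le (K M N : lmodType R)
    (f : {linear K -> M}) (g : {linear M -> N}) (n : nat) :
  left_noetherian R -> semiperfect R ->
  finitely_generated K -> finitely_generated N -> minimal_horseshoe f g ->
  pd_le M n <-> pd_le K n /\ pd_le N n.
Proof.
move=> noethR semiR K_fg N_fg hs.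
have [P minP] := minimal_resolution_exists noethR semiR K_fg.
have [Q minQ] := minimal_resolution_exists noethR semiR N_fg.
have [L [i [p [minL ip _ _ _]]]] := hs P Q minP minQ.
rewrite (minimal_pd_le n minL) (minimal_pd_le n minP) (minimal_pd_le n minQ).
split=> [L0|[P0 Q0] m nm x].
  split=> m nm x; have [i_inj _ p_surj] := ip m.
    by apply: i_inj; rewrite linear0 (L0 m nm (i m x)).
  by have [y <-] := p_surj x; rewrite (L0 m nm y) linear0.
have [_ ex _] := ip m; have [/(_ (Q0 m nm (p m x)))[y <-] _] := ex x.
by rewrite (P0 m nm y) linear0.
Qed.

End Resolutions.

Theorem theoremC (k : fieldType) (R : algType k)
    (R_noetherian : left_noetherian R)
    (R_semiperfect : semiperfect R)
    (R_augmented : augmented R)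
    (K M N : lmodType R) (f : {linear K -> M}) (g : {linear M -> N})
    (K_fg : finitely_generated K)
    (M_fg : finitely_generated M)
    (N_fg : finitely_generated N)
    (xi_exact : short_exact f g)
    (xi_horseshoe : minimal_horseshoe f g) :
  (projective M <-> projective K /\ projective N) /\
  pd M = Order.max (pd K) (pd N).
Proof.
have pd_leE n := minimal_horseshoe_pd_le n R_noetherian R_semiperfect
  K_fg N_fg xi_horseshoe.
(* The first claim is the case [n = 0] of [pd_leE]; the second uses all [n]. *)
by split; [rewrite !projective_pd_le0; apply: pd_leE | apply: pd_max].
Qed.
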